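(* Let $p$ be a prime number. Then the set of all solutions $(x,y,z)$ in non-negative integers of the Diophantine equation $$p^x + p^y = z^2$$ is exactly the following: - if $p = 2$: the triples $(2s+3,\, 2s,\, 3\cdot 2^s)$, $(2s,\, 2s+3,\, 3\cdot 2^s)$ and $(2s+1,\, 2s+1,\, 2^{s+1})$, where $s$ ranges over all non-negative integers; - if $p = 3$: the triples $(2s+1,\, 2s,\, 2\cdot 3^s)$ and $(2s,\, 2s+1,\, 2\cdot 3^s)$, where $s$ ranges over all non-negative integers; - if $p > 3$: there are no solutions. *)

(* Defs.v *)
From mathcomp Require Import all_boot.

Set Implicit Arguments.
Unset Strict Implicit.
Unset Printing Implicit Defensive.

(* Main.v *)
(* Dividing by the even part p^(2s) of p^(min x y) leaves p^n + p^b = w^2 with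
   b = 0 or 1.  If b = 1 then p divides w, so p^2 divides p^n + p, which forces
   n = 1 and p = 2.  If b = 0 then p^n = (w - 1)(w + 1), so w - 1 and w + 1 are
   powers of p differing by 2, namely 1, 3 or 2, 4. *)
Require Import Defs.
From mathcomp Require Import all_boot.
From mathcomp Require Import zify.

(** If [a = 0], the larger power is 3, so [p] divides 3. Otherwise the smaller power divides the
    larger one as well, hence divides their difference 2. *)
Lemma prime_powers_diff2 (p a c : nat) :
  prime p -> p ^ c = p ^ a + 2 ->
  (p = 3 /\ a = 0) \/ (p = 2 /\ a = 1).
Proof.
move=> p_pr; case: a => [|a] Eac.
  have p_dvd3 : p %| 3.
    case: c Eac => [//|c Eac].
    by rewrite -[3]/(1 + 2) -[1](expn0 p) -Eac expnS dvdn_mulr.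
  by left; split=> //; apply/eqP; rewrite -dvdn_prime2.
have a_lt_c : a.+1 < c.
  by rewrite -(ltn_exp2l _ _ (prime_gt1 p_pr)) Eac -[ltnLHS]addn0 ltn_add2l.
(* Used with [k = 1] to get [p = 2], then with [k = 2], where [4 %| 2] rules out a smaller exponent
   above 1. *)
have p_dvd2 k : p ^ k %| p ^ a.+1 -> p ^ k %| p ^ c -> p ^ k %| 2.
  by move=> da; rewrite Eac dvdn_addr.
have p2 : p = 2.
  apply/eqP; rewrite -dvdn_prime2 // -[p]expn1.
  by apply: p_dvd2; apply: dvdn_exp2l => //; apply: ltnW; apply: leq_trans a_lt_c.
right; split=> //; case: a a_lt_c p_dvd2 {Eac} => // a a_lt_c p_dvd2.
have: p ^ 2 %| 2 by apply: p_dvd2; apply: dvdn_exp2l => //; lia.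
by rewrite p2.
Qed.

Lemma expn_add1_square (p n w : nat) :
  prime p -> p ^ n + 1 = w ^ 2 ->
  [/\ p = 2, n = 3 & w = 3] \/ [/\ p = 3, n = 1 & w = 2].
Proof.
move=> p_pr Ew.
(* This makes the truncated [w - 1] a genuine difference, so that [w + 1] is [(w - 1) + 2]. *)
have w_gt1 : 1 < w.
  have pn_gt0 : 0 < p ^ n by rewrite expn_gt0 prime_gt0.
  by rewrite -ltn_sqr -Ew addn1.
have Epn : p ^ n = (w - 1) * (w + 1) by rewrite -subn_sqr exp1n; lia.
have /(@dvdn_pfactor _ _ _ p_pr)[a _ Ea] : w - 1 %| p ^ n.
  by rewrite Epn dvdn_mulr.
have /(@dvdn_pfactor _ _ _ p_pr)[c _ Ec] : w + 1 %| p ^ n.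
  by rewrite Epn dvdn_mull.
have [|[p3 a0]|[p2 a1]] := @prime_powers_diff2 p a c p_pr; first by lia.
- have w2 : w = 2 by move: Ea; rewrite a0 expn0; lia.
  right; split=> //; apply: (@expnI 3) => //.
  by move: Epn; rewrite w2 p3.
- have w3 : w = 3 by move: Ea; rewrite a1 p2; lia.
  left; split=> //; apply: (@expnI 2) => //.
  by move: Epn; rewrite w3 p2.
Qed.

Lemma expn_add_prime_square (p n w : nat) :
  prime p -> 0 < n -> p ^ n + p = w ^ 2 -> [/\ p = 2, n = 1 & w = 2].
Proof.
move=> p_pr n_gt0 Ew.
have p_dvdw : p %| w.
  have: p %| w ^ 2 by rewrite -Ew dvdn_addl // dvdn_exp.
  by rewrite Euclid_dvdX // => /andP[].
have p2_dvd : p ^ 2 %| p ^ n + p by rewrite Ew dvdn_exp2r.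
have n1 : n = 1.
  (* If [n > 1], then [p ^ 2] divides [p ^ n], hence also the other summand [p], which is absurd. *)
  apply/eqP; rewrite eqn_leq n_gt0 andbT leqNgt; apply/negP => n_gt1.
  move: p2_dvd; rewrite dvdn_addr ?dvdn_exp2l //.
  by rewrite -{2}[p]expn1 (dvdn_Pexp2l _ _ (prime_gt1 p_pr)).
have p2 : p = 2.
  (* With [n = 1] the sum is [2 * p]; cancelling [p] leaves [p %| 2]. *)
  move: p2_dvd; rewrite n1 expn1 addnn -mul2n -mulnn dvdn_pmul2r ?prime_gt0 //.
  by rewrite dvdn_prime2 // => /eqP.
by split=> //; move: Ew; rewrite n1 p2; nia.
Qed.

Lemma expn_add_expn_square (p x y z : nat) :
  prime p -> y <= x -> p ^ x + p ^ y = z ^ 2 ->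
  exists s, [\/ p = 2 /\ (x, y, z) = (2 * s + 3, 2 * s, 3 * 2 ^ s),
                p = 2 /\ (x, y, z) = (2 * s + 1, 2 * s + 1, 2 ^ (s + 1))
              | p = 3 /\ (x, y, z) = (2 * s + 1, 2 * s, 2 * 3 ^ s)].
Proof.
(* Halving the smaller exponent splits off [p ^ (2 * s)] and leaves the exponent [odd y], read as 0
   or 1. *)
move=> p_pr le_yx Ez; exists y./2; set s := y./2.
have Ey : y = 2 * s + odd y by rewrite mul2n addnC odd_double_half.
have [n Ex] : exists n, x = 2 * s + n by exists (x - 2 * s); lia.
have ps_gt0 : 0 < p ^ (2 * s) by rewrite expn_gt0 prime_gt0.
have Ez' : z ^ 2 = p ^ (2 * s) * (p ^ n + p ^ odd y).
  by rewrite -Ez {1}Ey Ex !expnD mulnDr.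
(* The square of [p ^ s] divides [z ^ 2], and divisibility of squares descends to their roots. *)
have /dvdnP[w Ew] : p ^ s %| z.
  by rewrite -(@dvdn_pexp2r _ _ 2) // -expnM mulnC Ez' dvdn_mulr.
have {Ez'} Enw : p ^ n + p ^ odd y = w ^ 2.
  apply/eqP; rewrite -(eqn_pmul2l ps_gt0) -Ez' Ew expnMn -expnM.
  by rewrite [s * 2]mulnC mulnC.
move: Ex Ey Ew Enw; case: (odd y) => /= Ex Ey Ew Enw.
  (* For odd [y], the bound [y <= x] reads [2 * s + 1 <= 2 * s + n], so [n] is positive. *)
  have [||p2 n1 w2] := @expn_add_prime_square p n w p_pr; [lia|by []|].
  by apply: Or32; rewrite Ex Ey Ew p2 n1 w2 expnD [2 ^ s * _]mulnC.
have [[p2 n3 w3]|[p3 n1 w2]] := @expn_add1_square p n w p_pr Enw.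
  by apply: Or31; rewrite Ex Ey Ew p2 n3 w3 addn0.
by apply: Or33; rewrite Ex Ey Ew p3 n1 w2 addn0.
Qed.

Theorem theorem3p2 (p : nat) (p_prime : prime p) :
  [/\ p = 2 ->
        forall x y z : nat,
          p ^ x + p ^ y = z ^ 2 <->
          exists s : nat,
            [\/ (x, y, z) = (2 * s + 3, 2 * s, 3 * 2 ^ s),
                (x, y, z) = (2 * s, 2 * s + 3, 3 * 2 ^ s)
              | (x, y, z) = (2 * s + 1, 2 * s + 1, 2 ^ (s + 1))],
      p = 3 ->
        forall x y z : nat,
          p ^ x + p ^ y = z ^ 2 <->
          exists s : nat,
            (x, y, z) = (2 * s + 1, 2 * s, 2 * 3 ^ s) \/
            (x, y, z) = (2 * s, 2 * s + 1, 2 * 3 ^ s)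
    & 3 < p ->
        forall x y z : nat, p ^ x + p ^ y <> z ^ 2].
Proof.
have sol x y z := @expn_add_expn_square p x y z p_prime.
split=> [p2|p3|p_gt3] x y z.
- split=> [Ez|[s [] [-> -> ->]]].
  + case: (leqP y x) => [le_yx|/ltnW le_xy].
      have [s [] [Ep [-> -> ->]]] := sol _ _ _ le_yx Ez; exists s.
      * exact: Or31.
      * exact: Or33.
      * by rewrite p2 in Ep.
    (* By symmetry, [sol] applies with [x] and [y] exchanged and gives the mirrored triples. *)
    rewrite addnC in Ez.
    have [s [] [Ep [-> -> ->]]] := sol _ _ _ le_xy Ez; exists s.
    * exact: Or32.
    * exact: Or33.
    * by rewrite p2 in Ep.
  (* Both orders come down to [8 + 1 = 9], times [2 ^ (2 * s)]. *)
  + by rewrite p2 expnMn -expnM [s * 2]mulnC expnD; lia.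
  + by rewrite p2 expnMn -expnM [s * 2]mulnC expnD; lia.
  + by rewrite p2 addnn -mul2n -expnS -expnM; congr (2 ^ _); lia.
- split=> [Ez|[s [] [-> -> ->]]].
  + case: (leqP y x) => [le_yx|/ltnW le_xy].
      have [s [] [Ep [-> -> ->]]] := sol _ _ _ le_yx Ez; exists s;
        [by rewrite p3 in Ep | by rewrite p3 in Ep | by left].
    rewrite addnC in Ez.
    have [s [] [Ep [-> -> ->]]] := sol _ _ _ le_xy Ez; exists s;
      [by rewrite p3 in Ep | by rewrite p3 in Ep | by right].
  (* Likewise [3 + 1 = 4], times [3 ^ (2 * s)]. *)
  + by rewrite p3 expnMn -expnM [s * 2]mulnC expnD; lia.
  + by rewrite p3 expnMn -expnM [s * 2]mulnC expnD; lia.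
(* Any solution would force [p] to be 2 or 3. *)
- move=> Ez; case: (leqP y x) => [le_yx|/ltnW le_xy].
    by have [s [] [Ep _]] := sol _ _ _ le_yx Ez; rewrite Ep in p_gt3.
  rewrite addnC in Ez.
  by have [s [] [Ep _]] := sol _ _ _ le_xy Ez; rewrite Ep in p_gt3.
Qed.
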